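(* Let $N,M\in\mathbb N$ and let $(x_n)_{n=1}^{N+M}$ be a frame for a Hilbert space $H$ such that $(x_n)_{n=1}^{N}$ is an orthonormal basis for $H$. Let $$x_n^{(0)}=x_n,\qquad\forall n=1,\ldots,N+M,$$ and for $k=1,\ldots,M$ $$x_n^{(k)}=\left(I+\theta_{x_{N+k}^{(k-1)},x_{N+k}^{(k-1)}}\right)^{-\frac12}x_n^{(k-1)},\qquad\forall n=1,\ldots,N+M.$$ Then the sequence $(x_n^{(M)})_{n=1}^{N+M}$ is a Parseval frame for $H$. If $(x_n)_{n=1}^{N+M}$ is full spark, then $(x_n^{(M)})_{n=1}^{N+M}$ is also a full spark frame.
   Context: $\mathbb N=\{1,2,\ldots\}$. $H$ is a complex Hilbert space (here $N$-dimensional) with inner product linear in the first argument. For $x,y\in H$, $\theta_{x,y}$ is the operator $\theta_{x,y}(v)=\langle v,y\rangle x$. For a positive invertible operator $S$, $S^{-\frac12}$ denotes the inverse of its positive square root. A finite sequence in $H$ is a frame iff it spans $H$; $(z_n)_{n=1}^{N+M}$ is a Parseval frame for $H$ if $\sum_{n=1}^{N+M}|\langle x,z_n\rangle|^2=\|x\|^2$ for all $x\in H$. A frame $(z_n)_{n=1}^{N+M}$ for the $N$-dimensional space $H$ is full spark if it becomes a basis for $H$ whenever any $M$ of its members are removed (equivalently, any $N$ of its members form a basis for $H$). *)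

(* Defs.v *)
From mathcomp Require Import all_boot all_order all_algebra.
From mathcomp Require Import complex.
From mathcomp Require Import boolp classical_sets reals.

Set Implicit Arguments.
Unset Strict Implicit.
Unset Printing Implicit Defensive.

Import Order.TTheory GRing.Theory Num.Theory.

Local Open Scope ring_scope.

(* A finite-dimensional complex Hilbert space is a [vectType] over R[i] with a
   positive definite Hermitian form; forms [{dot H for Num.conj}] are linear in
   the first argument and conjugate-linear in the second.  Completeness is
   automatic in finite dimension. *)
Section Hilbert.
Variables (R : realType) (H : vectType R[i]) (dot : {dot H for Num.conj}).

Definition theta (x y : H) : 'End(H) := linfun (fun v => dot v y *: x).

(* Over the complex numbers, [0 <= z] says that z is real and nonnegative, so
   a positive operator is automatically self-adjoint. *)
Definition positive_op (T : 'End(H)) : Prop := forall v : H, 0 <= dot (T v) v.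

(* The value is meaningful for positive S, which has exactly one such root;
   the default 0 is junk. *)
Definition sqrt_op (S : 'End(H)) : 'End(H) :=
  xget 0 [set T : 'End(H) | positive_op T /\ (T \o T)%VF = S]%classic.

(* [T^-1%VF] is the inverse of T when T is invertible. *)
Definition inv_sqrt_op (S : 'End(H)) : 'End(H) := ((sqrt_op S)^-1)%VF.

Definition orthonormal_basis (I : finType) (x : I -> H) : Prop :=
  orthonormal dot [seq x i | i : I] /\ basis_of fullv [seq x i | i : I].

Definition is_frame (I : finType) (x : I -> H) : Prop :=
  <<[seq x i | i : I]>>%VS = fullv.

Definition parseval_frame (I : finType) (z : I -> H) : Prop :=
  forall v : H, \sum_(i : I) `|dot v (z i)| ^+ 2 = dot v v.

Definition full_spark (N M : nat) (x : 'I_(N + M) -> H) : Prop :=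
  is_frame x /\
  forall D : {set 'I_(N + M)}, #|D| = M ->
    basis_of fullv [seq x i | i in ~: D].

End Hilbert.

(* Main.v *)
(* A positive operator T with T o T = I + theta_{c,c} is self-adjoint and
   invertible, hence
     <(I + theta_{c,c}) T^-1 v, T^-1 v> = ||v||^2 for every v.
   Expanding the left side, if a family z is Parseval then T^-1 z together with
   T^-1 c is Parseval.  Thus after k steps the first N + k vectors form a
   Parseval frame.  Each step applies a single invertible operator to the whole
   family, so it also preserves bases. *)
Require Import Defs.
From HB Require Import structures.
From mathcomp Require Import all_boot all_order all_algebra.
From mathcomp Require Import complex ring.
From mathcomp Require Import boolp classical_sets reals.

Set Implicit Arguments.
Unset Strict Implicit.
Unset Printing Implicit Defensive.

Import Order.TTheory GRing.Theory Num.Theory.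

Local Open Scope ring_scope.

Section Operators.
Variables (R : realType) (H : vectType R[i]) (dot : {dot H for Num.conj}).
Implicit Types (u v c : H) (T : 'End(H)).

Lemma dotC u v : dot u v = (dot v u)^*.
Proof. by rewrite (hermC dot u v) expr0 mul1r. Qed.

Lemma dotZl a u v : dot (a *: u) v = a * dot u v.
Proof. exact: linearZl_LR. Qed.

Lemma dotZr a u v : dot u (a *: v) = a^* * dot u v.
Proof. exact: linearZr_LR. Qed.

Lemma dotDl u u' v : dot (u + u') v = dot u v + dot u' v.
Proof. exact: linearDl. Qed.

Lemma dotDr u v v' : dot u (v + v') = dot u v + dot u v'.
Proof. exact: linearDr. Qed.

Lemma dot_suml (I : finType) (P : pred I) (F : I -> H) v :
  dot (\sum_(i | P i) F i) v = \sum_(i | P i) dot (F i) v.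
Proof. exact: linear_sumlz. Qed.

Lemma thetaE u c v : theta dot u c v = dot v c *: u.
Proof.
have lin : linear (fun w => dot w c *: u).
  by move=> a w w' /=; rewrite dotDl dotZl scalerDl scalerA.
pose f : {linear H -> H} :=
  HB.pack (fun w => dot w c *: u) (GRing.isLinear.Build _ _ _ _ _ lin).
exact: (lfunE f v).
Qed.

Lemma add1_thetaE c v :
  (\1 + theta dot c c)%VF v = v + dot v c *: c.
Proof. by rewrite add_lfunE id_lfunE thetaE. Qed.

Lemma dot_add1_theta c v :
  dot ((\1 + theta dot c c)%VF v) v = dot v v + `|dot v c| ^+ 2.
Proof. by rewrite add1_thetaE dotDl dotZl normCK -dotC. Qed.

(** Polarization: the defect [D] is sesquilinear and vanishes on the diagonal, because positivity
    makes each <T w, w> real. Testing [u + a *: v] with a = 1 and a = i then forces D u v = 0. *)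
Lemma positive_op_selfadjoint T u v :
  positive_op dot T -> dot (T u) v = dot u (T v).
Proof.
move=> Tpos; apply/eqP; rewrite -subr_eq0; apply/eqP.
pose D w w' := dot (T w) w' - dot w (T w').
have D0 w : D w w = 0.
  by rewrite /D [dot w _]dotC (CrealP (ger0_real (Tpos w))) subrr.
have Dadd a : D (u + a *: v) (u + a *: v) = a^* * D u v + a * D v u.
  have Tuv : T (u + a *: v) = T u + a *: T v by rewrite linearD linearZ.
  move: (D0 u) (D0 v); rewrite /D Tuv.
  rewrite !dotDl !dotDr !dotZl !dotZr.
  move=> /eqP + /eqP; rewrite !subr_eq0 => /eqP-> /eqP->.
  ring.
have := Dadd 1; have := Dadd 'i; rewrite !D0 rmorph1 conjCi !mul1r => + e1.
have -> : D v u = - D u v by apply/eqP; rewrite -addr_eq0 addrC -e1.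
move=> /esym/eqP; rewrite mulNr mulrN -opprD oppr_eq0 -mulrDl mulf_eq0.
by rewrite -mulr2n mulrn_eq0 (negPf (neq0Ci _)) => /eqP.
Qed.

(* The root is I + a theta_{c,c}, where a solves a^2 ||c||^2 + 2 a = 1. *)
Lemma sqrt_add1_theta_exists c : exists T,
  positive_op dot T /\ (T \o T)%VF = (\1 + theta dot c c)%VF.
Proof.
(* The nonnegative solution (r - 1) / ||c||^2, rationalised to 1 / (1 + r) so that c = 0 is covered
   too. *)
pose r := sqrtC (1 + dot c c); pose a := (1 + r)^-1.
have s0 : 0 <= dot c c by exact: dnorm_ge0.
have r0 : 0 <= r by rewrite sqrtC_ge0 addr_ge0.
have r1 : 1 + r != 0 by rewrite gt_eqF // ltr_wpDr.
have a0 : 0 <= a by rewrite invr_ge0 addr_ge0.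
have aE : a + a + a * a * dot c c = 1.
  have -> : dot c c = r ^+ 2 - 1 by rewrite sqrtCK addrC addKr.
  by rewrite /a; field.
have TE v : (\1 + a *: theta dot c c)%VF v = v + (a * dot v c) *: c.
  by rewrite add_lfunE id_lfunE scale_lfunE thetaE scalerA.
exists (\1 + a *: theta dot c c)%VF; split=> [v|].
  rewrite TE dotDl dotZl -mulrA [dot c v]dotC -normCK.
  by rewrite addr_ge0 ?dnorm_ge0 ?mulr_ge0 ?exprn_ge0.
apply/lfunP=> v; rewrite comp_lfunE !TE add1_thetaE dotDl dotZl.
rewrite -addrA -scalerDl; congr (_ + _ *: _).
by rewrite -[RHS]mul1r -aE; ring.
Qed.

(** Since a root exists, [xget] returns an element of the set instead of its default 0. *)
Lemma sqrt_add1_thetaP c (S := (\1 + theta dot c c)%VF) :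
  positive_op dot (sqrt_op dot S) /\ (sqrt_op dot S \o sqrt_op dot S)%VF = S.
Proof.
have [T TP] := sqrt_add1_theta_exists c.
exact: (@xgetPex _ 0 [set T | positive_op dot T /\ (T \o T)%VF = S]%classic)
  (ex_intro _ T TP).
Qed.

(** If T v = 0 for the root T, then 0 = <T (T v), v> = ||v||^2 + |<v, c>|^2, so v = 0. *)
Lemma lker_sqrt_add1_theta c :
  lker (sqrt_op dot (\1 + theta dot c c)%VF) == 0%VS.
Proof.
have [_ TT] := sqrt_add1_thetaP c; rewrite -subv0.
apply/subvP=> v; rewrite memv_ker memv0 => /eqP Tv0.
have := dot_add1_theta c v; rewrite -TT comp_lfunE Tv0 linear0 linear0l.
move=> /esym/eqP; rewrite paddr_eq0 ?dnorm_ge0 ?exprn_ge0 //.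
by rewrite dnorm_eq0 => /andP[].
Qed.

Lemma dot_inv_sqrt_add1_theta c v
    (A := inv_sqrt_op dot (\1 + theta dot c c)%VF) :
  dot (A v) (A v) + `|dot (A v) c| ^+ 2 = dot v v.
Proof.
have [Tpos TT] := sqrt_add1_thetaP c.
rewrite -dot_add1_theta -TT comp_lfunE positive_op_selfadjoint //.
by rewrite /A /inv_sqrt_op lker0_lfunVK // lker_sqrt_add1_theta.
Qed.

(** Self-adjointness passes from the root T to its inverse by writing u = T (A u) and v = T (A v).
    It serves to move A from the frame vectors onto the tested vector. *)
Lemma inv_sqrt_add1_theta_selfadjoint c u v
    (A := inv_sqrt_op dot (\1 + theta dot c c)%VF) :
  dot (A u) v = dot u (A v).
Proof.
have [Tpos _] := sqrt_add1_thetaP c; have kT := lker_sqrt_add1_theta c.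
rewrite -[v in LHS](lker0_lfunVK kT) -[u in RHS](lker0_lfunVK kT).
by rewrite [RHS]positive_op_selfadjoint.
Qed.

Lemma lker_inv_sqrt_add1_theta c :
  lker (inv_sqrt_op dot (\1 + theta dot c c)%VF) == 0%VS.
Proof. exact/lker0P/(can_inj (lker0_lfunVK (lker_sqrt_add1_theta c))). Qed.

Lemma parseval_orthonormal_basis (I : finType) (x : I -> H) :
  orthonormal_basis dot x -> parseval_frame dot x.
Proof.
case=> xon xb v; have ux : uniq [seq x i | i : I].
  exact: free_uniq (basis_free xb).
have xI : injective x by apply/injectiveP.
have [_ xo] := orthonormalP xon.
have xij i j : dot (x i) (x j) = (i == j)%:R.
  by rewrite xo ?map_f ?mem_enum ?(inj_eq xI) // -enumT mem_enum.
have vX : v \in <<[seq x i | i : I]>>%VS by rewrite (span_basis xb) memvf.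
have [k -> _] := free_span (basis_free xb) vX.
rewrite big_image /=; set w := \sum_(i in I) k (x i) *: x i.
(* Orthonormality identifies the coordinates with the inner products. *)
have wx j : dot w (x j) = k (x j).
  rewrite dot_suml (bigD1 j) //= dotZl xij eqxx mulr1 big1 ?addr0 // => i.
  by rewrite dotZl xij => /negPf->; rewrite mulr0.
rewrite {2}/w dot_suml; apply: eq_bigr => i _.
by rewrite normCK dotZl [dot (x i) w]dotC wx.
Qed.

End Operators.

(** In finite dimension an injective endomorphism is onto, so the image still spans [fullv]. *)
Lemma basis_of_limg (K : fieldType) (H : vectType K) (f : 'End(H)) (X : seq H) :
  lker f == 0%VS -> basis_of fullv X -> basis_of fullv (map f X).
Proof.
move=> kf bX; rewrite -(lker0_limgf kf); apply: limg_basis_of => //.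
by rewrite (eqP kf) capv0.
Qed.

(* The k-th vector of the tail (x_{N+1}, ..., x_{N+M}), counted from 0, is
   [x (rshift N k)]; [lshift M i] indexes the first N vectors. *)
Theorem corollary4p17 (R : realType) (H : vectType R[i])
    (dot : {dot H for Num.conj}) (N M : nat) (hN : (0 < N)%N) (hM : (0 < M)%N)
    (x : 'I_(N + M) -> H) (hframe : is_frame x)
    (honb : orthonormal_basis dot (fun i : 'I_N => x (lshift M i)))
    (y : nat -> 'I_(N + M) -> H)
    (hy0 : forall n : 'I_(N + M), y 0%N n = x n)
    (hyS : forall (k : 'I_M) (n : 'I_(N + M)),
       y k.+1 n =
       inv_sqrt_op dot
         (\1%VF + theta dot (y k (rshift N k)) (y k (rshift N k))) (y k n)) :
  parseval_frame dot (y M) /\ (full_spark x -> full_spark (y M)).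
Proof.
(* After k steps the first N + k vectors are Parseval; at k = M these are all of them. *)
pose inv k := forall v,
  \sum_(i < N + M | (i < N + k)%N) `|dot v (y k i)| ^+ 2 = dot v v.
have invP k : (k <= M)%N -> inv k.
  elim: k => [_ v|k IHk ltkM v].
    rewrite -(parseval_orthonormal_basis honb v) big_split_ord /=.
    rewrite [X in _ + X]big1 ?addr0 => [|i]; last first.
      by rewrite addn0 ltnNge leq_addr.
    by apply: eq_big => [i|i _]; rewrite ?addn0 ?ltn_ord ?hy0.
  pose k' := Ordinal ltkM; set c := y k (rshift N k').
  (* The induction hypothesis is used at A v, with A the current inverse root; the extra term |<A v,
     c>|^2 is the summand of index N + k, counted from 0. *)
  rewrite -(dot_inv_sqrt_add1_theta dot c v) -(IHk (ltnW ltkM)).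
  rewrite (bigD1 (rshift N k')) /= ?addnS ?ltnSn // addrC.
  congr (_ + _); last by rewrite (hyS k') -inv_sqrt_add1_theta_selfadjoint.
  apply: eq_big => [i|i _].
    by rewrite ltnS -val_eqE /= andbC -ltn_neqAle.
  by rewrite (hyS k') -inv_sqrt_add1_theta_selfadjoint.
have parM : parseval_frame dot (y M).
  move=> v; rewrite -(invP M (leqnn M) v).
  by apply: eq_bigl => i; rewrite ltn_ord.
split=> // -[_ spark].
(* The M inverse roots compose to one injective operator carrying [x] to [y M]. *)
have [A kA yA] : exists2 A : 'End(H), lker A == 0%VS & y M =1 A \o x.
  suff /(_ M (leqnn M)) : forall k, (k <= M)%N ->
      exists2 A : 'End(H), lker A == 0%VS & y k =1 A \o x by [].
  elim=> [_|k IHk ltkM].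
    exists \1%VF => [|n]; last by rewrite hy0 /= id_lfunE.
    by apply/lker0P=> u v; rewrite !id_lfunE.
  have [A kA yA] := IHk (ltnW ltkM); pose k' := Ordinal ltkM.
  pose c := y k (rshift N k'); set B := inv_sqrt_op dot (\1%VF + theta dot c c).
  exists (B \o A)%VF => [|n]; last first.
    by rewrite /= comp_lfunE (hyS k') [y k n]yA.
  apply/lker0P => u v; rewrite !comp_lfunE.
  move=> /(lker0P (lker_inv_sqrt_add1_theta _ _)).
  exact: (lker0P kA).
have mapA (D : {pred 'I_(N + M)}) :
    [seq y M i | i in D] = map A [seq x i | i in D].
  by rewrite -map_comp; apply: eq_map.
split=> [|D cD]; last by rewrite mapA basis_of_limg ?spark.
by rewrite /is_frame mapA -limg_span hframe lker0_limgf.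
Qed.
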